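(* Let $v \geq t$ be positive integers, let $X$ be an $\mathsf{SCA}(N;t,v)$ and let $0<a<t$. Then every array $\mathsf{C} \in \mathcal{C}_a(X)$ is a $\mathsf{CA}_X(|\mathsf{C}|;\,t-a,\,v-a,\,a+1)$, where $|\mathsf{C}|$ is the number of rows of $\mathsf{C}$. Moreover, if $X$ is an $\mathsf{SCA}(t!;t,v)$, then for every $\mathsf{C} \in \mathcal{C}_a(X)$ each $(t-a)$-way interaction $T$ (on the columns of $\mathsf{C}$, with symbols in $[a+1]$) is covered by exactly $\mu(T)$ rows of $\mathsf{C}$.
   Context: For a positive integer $v$, let $[v] = \{0,\dots,v-1\}$ and let $\mathcal{S}_v$ be the set of permutations of $[v]$, in one-line notation $\pi(0)\pi(1)\cdots\pi(v-1)$. A permutation $\pi \in \mathcal{S}_v$ covers a sequence $(s_0,\dots,s_{m-1})$ of distinct elements of $[v]$ if $\pi^{-1}(s_i)<\pi^{-1}(s_{i+1})$ for $0\leq i\leq m-2$. A sequence covering array $\mathsf{SCA}(N;t,v)$, $v\geq t$, is a set $X$ of $N$ permutations in $\mathcal{S}_v$ such that every sequence of $t$ distinct elements of $[v]$ is covered by at least one $\pi\in X$. For an array with entries in the alphabet $[w]$, a $t'$-way interaction is a set of $t'$ pairs $T=\{(c_i,\nu_i): 0\leq i\leq t'-1\}$ where the $c_i$ are distinct columns and each $\nu_i\in[w]$; a row covers $T$ if its entry in column $c_i$ is $\nu_i$ for all $i$. For $\sigma\in[w]$ let $\tau_\sigma(T)=\{c_i:\nu_i=\sigma\}$, and let $\mu(T)=\prod_{\sigma=0}^{w-1}|\tau_\sigma(T)|!$.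 An excess coverage array $\mathsf{CA}_X(N';t',k,w)$ is an $N'\times k$ array with entries in $[w]$ (rows regarded as a multiset) such that each $t'$-way interaction $T$ is covered by at least $\mu(T)$ rows. Construction of $\mathcal{C}_a(X)$: given an $\mathsf{SCA}(N;t,v)$ $X$ and $0<a<t$, choose a set $A$ of $a$ symbols of $[v]$ and a permutation (ordering) $u$ of the symbols of $A$. Let $X_u$ be the set of permutations in $X$ that cover $u$. Let $\mathsf{C}$ be the $|X_u|\times(v-a)$ array with rows indexed by the permutations in $X_u$ and columns indexed by the symbols in $[v]\setminus A$, where the entry in row $\rho$ and column $\nu$ is the number of symbols of $A$ that precede $\nu$ in the permutation $\rho$. $\mathcal{C}_a(X)$ is the multiset of the $v!/(v-a)!$ arrays obtained in this way over all choices of $A$ and $u$. *)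

(* Defs.v *)
(* MathComp world: everything is finite combinatorics. *)
From HB Require Import structures.
From mathcomp Require Import all_boot all_fingroup.

Set Implicit Arguments.
Unset Strict Implicit.
Unset Printing Implicit Defensive.

(* The one-line notation of pi : 'S_v lists the symbol [pi i] in position [i],
   so the position of the symbol [x] is [pi^-1 x]. *)
Definition precedes v (pi : 'S_v) : rel 'I_v :=
  fun x y => (pi^-1)%g x < (pi^-1)%g y.

(* Meant for sequences [s] of distinct symbols. [sorted] compares consecutive
   entries only. *)
Definition covers v (pi : 'S_v) (s : seq 'I_v) : bool :=
  sorted (precedes pi) s.

Definition is_SCA (N t v : nat) (X : {set 'S_v}) : Prop :=
  [/\ t <= v, #|X| = N &
      forall s : t.-tuple 'I_v, uniq s -> exists2 pi, pi \in X & covers pi s].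

(* Rows are indexed by a finite type, so equal rows may be repeated: an array
   has a multiset of rows. Entries are natural numbers; membership in the
   alphabet [w] is one of the requirements of [is_CAX]. *)
Record array := Array {
  array_row : finType;
  array_col : finType;
  array_entry : array_row -> array_col -> nat }.

Section Interactions.
Variables (K : finType) (w : nat).
Implicit Type T : {set K * 'I_w}.

Definition is_interaction (t' : nat) T : Prop :=
  #|T| = t' /\ {in T &, injective fst}.

Definition tau (sigma : 'I_w) T : {set K} := [set c | (c, sigma) \in T].

Definition mu T : nat := \prod_(sigma < w) #|tau sigma T|`!.
End Interactions.

Definition covering_rows (C : array) w (T : {set array_col C * 'I_w}) :
    {set array_row C} :=
  [set r | [forall p in T, array_entry r p.1 == p.2 :> nat]].

Definition is_CAX (N' t' k w : nat) (C : array) : Prop :=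
  [/\ #|array_row C| = N', #|array_col C| = k,
      forall (r : array_row C) (c : array_col C), array_entry r c < w &
      forall T : {set array_col C * 'I_w},
        is_interaction t' T -> mu T <= #|covering_rows T|].

(* The pairs (A, u) of a set A of [a] symbols and an ordering u of A. *)
Definition ordered_choice (a v : nat) :=
  {p : {set 'I_v} * a.-tuple 'I_v | (#|p.1| == a) && perm_eq p.2 (enum p.1)}.

Definition choice_array v (X : {set 'S_v}) (A : {set 'I_v}) (u : seq 'I_v) :
    array :=
  Array (fun (rho : {rho : 'S_v | rho \in [set pi in X | covers pi u]})
             (nu : {nu : 'I_v | nu \notin A}) =>
           #|[set x in A | precedes (val rho) x (val nu)]|).

(* The multiset C_a(X), as a family indexed by the choices (A, u). *)
Definition calC a v (X : {set 'S_v}) (c : ordered_choice a v) : array :=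
  choice_array X (val c).1 (val c).2.

(* Main.v *)
Require Import Defs.
From HB Require Import structures.
From mathcomp Require Import all_boot all_fingroup zify.

Set Implicit Arguments.
Unset Strict Implicit.
Unset Printing Implicit Defensive.

(** Fix a choice (A, u) and an interaction [T] on a set [B] of t - a columns, and
    put S = A :|: B, a set of [t] symbols.  Whether a permutation covers [u] and
    then, as a row, covers [T] depends only on the order in which it lists the
    symbols of [S] (its restriction to [S]).  The orders that work are those of
    the form
      [tau_0 in any order], u_0, [tau_1 in any order], u_1, ..., [tau_a],
    because a column with entry [nu] must lie after exactly the first [nu]
    symbols of [u].  There are [mu T] such orders.

    To count them without handling blocks explicitly, each symbol of [S] gets a
    slot: 2 nu for a column with entry [nu], and 2 i + 1 for [u_i].  The orders
    above are exactly those along which slots weakly increase ([row_coversE]), and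
    the number of slot-sorted orders of a set is the product of the factorials
    of the sizes of the slots ([count_key_sorted]); odd slots contribute 1.

    In a sequence covering array every order of [S] is the restriction of some
    member, so at least one row realises each of the [mu T] orders
    ([SCA_count_ge]).  If the array has only t! members, restriction maps it
    onto the t! orders of [S], hence bijectively, and the count is exact
    ([SCA_count_eq]). *)

(** * Counting orderings sorted by a key *)

Lemma prod_even_odd (F : nat -> nat) n :
  \prod_(i < n.*2) F i = \prod_(i < n) (F i.*2 * F i.*2.+1).
Proof.
elim: n => [|n IHn]; first by rewrite !big_ord0.
by rewrite doubleS !big_ord_recr /= IHn mulnA.
Qed.

Lemma key_le_trans (K : Type) (key : K -> nat) : transitive (relpre key leq).
Proof. by move=> ? ? ? /=; apply: leq_trans. Qed.

(** Splitting off the block of largest key drives the induction on the number of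
    keys. *)
Lemma key_sorted_cat (K : eqType) (key : K -> nat) n (s : seq K) :
  sorted (relpre key leq) s -> all (fun x => key x < n.+1) s ->
  s = [seq x <- s | key x < n] ++ [seq x <- s | key x == n].
Proof.
elim: s => //= x s IHs path_s /andP[lt_x lt_s].
have {1}-> := IHs (path_sorted path_s) lt_s.
case: (ltngtP (key x) n) lt_x => //= [|eq_x _]; first by lia.
suff -> : [seq y <- s | key y < n] = [::] by [].
have le_tr := @key_le_trans _ key.
have/allP ge_s := order_path_min le_tr path_s.
apply/eqP; rewrite -[_ == _]negbK -has_filter -all_predC; apply/allP => y /ge_s.
by rewrite /= -leqNgt eq_x.
Qed.

(** A sorted ordering is a concatenation of arbitrary orderings of the key
    classes. *)
Lemma count_key_sorted (K : eqType) (key : K -> nat) n (s : seq K) :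
  uniq s -> all (fun x => key x < n) s ->
  count (sorted (relpre key leq)) (permutations s) =
    \prod_(k < n) (count (fun x => key x == k) s)`!.
Proof.
elim: n s => [|n IHn] s uniq_s lt_s.
  by case: s lt_s {uniq_s} => // _; rewrite big_ord0.
have le_tr := @key_le_trans _ key.
pose s1 := [seq x <- s | key x < n]; pose s2 := [seq x <- s | key x == n].
have perm_s12 : perm_eq s (s1 ++ s2).
  rewrite perm_sym -(permPr (permEl (perm_filterC (fun x => key x < n) s))).
  rewrite perm_cat2l.
  rewrite (_ : s2 = [seq x <- s | predC (fun x => key x < n) x]) //.
  by apply: eq_in_filter => x /(allP lt_s) /=; case: ltngtP; lia.
have uniq_s1 : uniq s1 by apply: filter_uniq.
have lt_s1 : all (fun x => key x < n) s1 by apply: filter_all.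
rewrite big_ord_recr /= -[X in _ * X`!]size_filter -/s2.
transitivity (count (sorted (relpre key leq)) (permutations s1) * (size s2)`!);
  last first.
  congr (_ * _); rewrite IHn //; apply: eq_bigr => k _; congr (_`!).
  rewrite count_filter; apply: eq_count => x /=.
  by have := ltn_ord k; lia.
rewrite -size_permutations ?filter_uniq // -!size_filter -(size_allpairs cat).
pose L := [seq w ++ p | w <- [seq w <- permutations s1 |
             sorted (relpre key leq) w], p <- permutations s2].
apply: (@perm_size _ _ L); apply: uniq_perm.
- exact/filter_uniq/permutations_uniq.
- (* The prefixes all have the same length, so a concatenation determines its
     two parts. *)
  apply: allpairs_uniq; rewrite ?filter_uniq ?permutations_uniq //.
  move=> [w p] [w' p'] /allpairsP[[w1 p1] /= [w1P _ [-> ->]]].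
  move=> /allpairsP[[w2 p2] /= [w2P _ [-> ->]]] /eqP.
  move: w1P w2P; rewrite !mem_filter !mem_permutations.
  move=> /andP[_ /perm_size sz1] /andP[_ /perm_size sz2].
  by rewrite eqseq_cat ?sz1 ?sz2 // => /andP[/eqP-> /eqP->].
- move=> w; rewrite mem_filter mem_permutations; apply/andP/allpairsP.
    case=> sorted_w perm_w.
    exists ([seq x <- w | key x < n], [seq x <- w | key x == n]) => /=.
    rewrite mem_filter !mem_permutations !perm_filter //.
    rewrite (sorted_filter le_tr) //.
    by split=> //; apply: key_sorted_cat; rewrite // (perm_all _ perm_w).
  case=> [[w1 p] /= []]; rewrite mem_filter !mem_permutations.
  case/andP=> sorted_w1 perm_w1 perm_p ->; split; last first.
    by rewrite perm_sym (permPl perm_s12) perm_sym perm_cat.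
  rewrite (sorted_pairwise le_tr) pairwise_cat.
  rewrite -!(sorted_pairwise le_tr) sorted_w1.
  apply/and3P; split=> //.
    apply/allrelP => x y; rewrite (perm_mem perm_w1) (perm_mem perm_p).
    by rewrite !mem_filter /= => /andP[lt_x _] /andP[/eqP-> _]; apply: ltnW.
  have: all (fun x => key x == n) p by rewrite (perm_all _ perm_p) filter_all.
  elim: p {perm_p} => //= x p IHp /andP[/eqP eq_x eq_p].
  rewrite (path_sortedE le_tr) IHp // andbT; apply/allP => y /(allP eq_p).
  by rewrite /= eq_x => /eqP->.
Qed.

(** The elements satisfying a predicate closed under predecessors form a prefix,
    whose length is their number. *)
Lemma index_lt_count (K : eqType) (P : pred K) (s : seq K) x :
  pairwise (fun x y => P y ==> P x) s -> x \in s ->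
  (index x s < count P s) = P x.
Proof.
elim: s => //= y s IHs /andP[/allP Py pw]; rewrite inE.
case: (boolP (P y)) => [Pyy | nPy].
  by case: eqVneq => [->|_ /= /(IHs pw) <-].
have nPs : {in s, forall z, P z = false}.
  by move=> z /Py /implyP Pz; apply: contraNF nPy.
rewrite (eq_in_count nPs) count_pred0 add0n ltn0.
by case/predU1P => [->|/nPs->]; rewrite ?(negPf nPy).
Qed.

(** * Restricting a permutation to a set of symbols *)

Section Restriction.
Variable v : nat.
Implicit Types (pi : 'S_v) (S A B : {set 'I_v}) (X : {set 'S_v}).

Lemma precedes_trans pi : transitive (precedes pi).
Proof. by move=> y x z; apply: ltn_trans. Qed.

Lemma precedes_irr pi : irreflexive (precedes pi).
Proof. by move=> x; apply: ltnn. Qed.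

Lemma precedes_total pi x y : x != y -> ~~ precedes pi x y = precedes pi y x.
Proof.
rewrite /precedes -leqNgt leq_eqVlt eq_sym val_eqE (inj_eq perm_inj).
by move=> /negPf->.
Qed.

Definition restriction pi S : seq 'I_v :=
  [seq x <- [seq pi i | i <- enum 'I_v] | x \in S].

Lemma mem_restriction pi S : restriction pi S =i S.
Proof.
move=> x; rewrite mem_filter andb_idr // => _.
by rewrite -(permKV pi x) map_f ?mem_enum.
Qed.

Lemma covers_restriction pi S : covers pi (restriction pi S).
Proof.
apply: (sorted_filter (@precedes_trans pi)).
rewrite sorted_map (eq_sorted (e' := relpre val ltn)).
  by rewrite -sorted_map val_enum_ord iota_ltn_sorted.
by move=> i j; rewrite /= /precedes !permK.
Qed.

(** Two different orders of one set cannot both be covered by [pi]; this is what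
    makes the lower bound on the number of rows a count of distinct rows. *)
Lemma restriction_unique pi S w :
  perm_eq w (enum S) -> covers pi w -> restriction pi S = w.
Proof.
move=> perm_w cov_w.
apply: (irr_sorted_eq (@precedes_trans pi) (@precedes_irr pi)) => //.
  exact: covers_restriction.
by move=> x; rewrite mem_restriction (perm_mem perm_w) mem_enum.
Qed.

(** Since [pi] totally orders [S], weak monotonicity of the key along [pi] can be
    tested by its contrapositive, one pair of symbols at a time. *)
Lemma sorted_restriction pi S (key : 'I_v -> nat) :
  reflect {in S &, forall x y, key x < key y -> precedes pi x y}
          (sorted (relpre key leq) (restriction pi S)).
Proof.
have le_tr := @key_le_trans _ key.
apply: (iffP idP) => [key_sorted x y Sx Sy lt_xy | mono].
  apply: (sorted_ltn_index (@precedes_trans pi) (covers_restriction pi S));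
    rewrite ?mem_restriction //.
  rewrite ltnNge; apply/negP => le_yx.
  have le_key := sorted_leq_index le_tr (fun x => leqnn (key x)) key_sorted.
  have := le_key y x; rewrite !mem_restriction /= => /(_ Sy Sx le_yx).
  by rewrite leqNgt lt_xy.
have all_S : all (mem S) (restriction pi S).
  by apply/allP => x; rewrite mem_restriction.
apply: sub_in_sorted all_S (covers_restriction pi S) => x y Sx Sy prec_xy /=.
rewrite leqNgt; apply/negP => /(mono _ _ Sy Sx) prec_yx.
by have := precedes_trans prec_xy prec_yx; rewrite precedes_irr.
Qed.

Lemma permutations_sub_restrictions N t X S :
  is_SCA N t X -> #|S| = t ->
  {subset permutations (enum S) <= [seq restriction pi S | pi <- enum X]}.
Proof.
case=> _ _ coverX cardS w; rewrite mem_permutations => perm_w.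
have size_w : size w == t by rewrite (perm_size perm_w) -cardE cardS.
have uniq_w : uniq (Tuple size_w) by rewrite (perm_uniq perm_w) enum_uniq.
have [pi Xpi cov_w] := coverX _ uniq_w.
rewrite -(restriction_unique perm_w cov_w).
by apply: (map_f (restriction^~ S)); rewrite mem_enum.
Qed.

Lemma card_restriction X S (P : pred (seq 'I_v)) :
  #|[set pi in X | P (restriction pi S)]| =
    count P [seq restriction pi S | pi <- enum X].
Proof.
rewrite count_map -size_filter cardE /enum_mem -filter_predI.
by congr size; apply: eq_filter => pi; rewrite !inE andbC.
Qed.

Lemma SCA_count_ge N t X S (P : pred (seq 'I_v)) :
  is_SCA N t X -> #|S| = t ->
  count P (permutations (enum S)) <= #|[set pi in X | P (restriction pi S)]|.
Proof.
move=> scaX cardS; rewrite card_restriction -!size_filter.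
apply: uniq_leq_size; first exact/filter_uniq/permutations_uniq.
move=> w; rewrite !mem_filter => /andP[-> /=].
exact: permutations_sub_restrictions scaX cardS w.
Qed.

(** With t! members, the list of restrictions to [S] contains the t! orderings of
    [S] and is no longer than their list, so it is a rearrangement of it. *)
Lemma SCA_count_eq t X S (P : pred (seq 'I_v)) :
  is_SCA t`! t X -> #|S| = t ->
  #|[set pi in X | P (restriction pi S)]| = count P (permutations (enum S)).
Proof.
move=> scaX cardS; rewrite card_restriction; apply/seq.permP: P.
have sub := permutations_sub_restrictions scaX cardS.
have le_size : size [seq restriction pi S | pi <- enum X] <=
               size (permutations (enum S)).
  case: scaX => _ cardX _.
  by rewrite size_map size_permutations ?enum_uniq // -!cardE cardS cardX.
have uniq_perms := permutations_uniq (enum S).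
apply: uniq_perm => //; first exact: leq_size_uniq uniq_perms sub le_size.
by have [_ eq_mem] := uniq_min_size uniq_perms sub le_size; move=> w.
Qed.

(** * Rows covering an interaction *)

(** Odd values are the places of the symbols of [u], even ones the gaps between
    them: gap 2 l lies after exactly [l] symbols of [u]. *)
Definition slot (u : seq 'I_v) (lev : 'I_v -> nat) (x : 'I_v) : nat :=
  if x \in u then (index x u).*2.+1 else (lev x).*2.

Lemma card_preceding pi A u x : perm_eq u (enum A) ->
  #|[set y in A | precedes pi y x]| = count (fun y => precedes pi y x) u.
Proof.
move=> perm_u; have uniq_u : uniq u by rewrite (perm_uniq perm_u) enum_uniq.
rewrite -size_filter -(card_uniqP (filter_uniq _ uniq_u)).
by apply: eq_card => y; rewrite inE mem_filter (perm_mem perm_u) mem_enum andbC.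
Qed.

Lemma precedes_index pi A u x y :
    perm_eq u (enum A) -> covers pi u -> y \in u ->
  precedes pi y x = (index y u < #|[set y in A | precedes pi y x]|).
Proof.
move=> perm_u cov_u uy; rewrite (card_preceding _ _ perm_u) index_lt_count //.
move: cov_u; rewrite /covers (sorted_pairwise (@precedes_trans pi)).
apply: sub_pairwise => y1 y2 prec12; apply/implyP.
exact: precedes_trans prec12.
Qed.

(** The symbols of [A] preceding [b] form a prefix of [u], of length the entry in
    column [b].  So prescribing that entry to be [lev b] amounts to saying, for
    each symbol of [u], on which side of [b] it lies, which is what comparing the
    slots does. *)
Lemma row_coversE pi A B u lev :
    perm_eq u (enum A) -> [disjoint A & B] -> {in B, forall b, lev b <= #|A|} ->
  covers pi u && [forall b in B, #|[set x in A | precedes pi x b]| == lev b] =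
    sorted (relpre (slot u lev) leq) (restriction pi (A :|: B)).
Proof.
move=> perm_u disjAB lev_le.
have uA x : (x \in u) = (x \in A) by rewrite (perm_mem perm_u) mem_enum.
have uB x : x \in B -> (x \in u) = false.
  by rewrite uA => /(disjointFl disjAB).
have size_u : size u = #|A| by rewrite (perm_size perm_u) -cardE.
have uniq_u : uniq u by rewrite (perm_uniq perm_u) enum_uniq.
have neqAB x y : x \in A -> y \in B -> x != y.
  by rewrite -uA => ux By; apply: contraTneq ux => ->; rewrite uB.
have slotA x : x \in A -> slot u lev x = (index x u).*2.+1.
  by rewrite /slot uA => ->.
have slotB x : x \in B -> slot u lev x = (lev x).*2.
  by rewrite /slot => /uB->.
apply/andP/sorted_restriction => [[cov_u /forall_inP lev_eq] x y | mono].
  have lt_lev x1 b : x1 \in A -> b \in B ->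
      precedes pi x1 b = (index x1 u < lev b).
    move=> Ax Bb; rewrite -(eqP (lev_eq b Bb)).
    by apply: precedes_index; rewrite ?uA.
  rewrite !inE => /orP[Ax|Bx] /orP[Ay|By].
  - rewrite !slotA // ltnS ltn_double => lt_xy.
    by apply: (sorted_ltn_index (@precedes_trans pi) cov_u); rewrite ?uA.
  - by rewrite slotA // slotB // => lt_xy; rewrite lt_lev //; lia.
  - rewrite (slotA y) // slotB // => lt_xy.
    by rewrite -precedes_total ?neqAB // lt_lev //; lia.
  - (* If [y] came first, every symbol of [A] before [y] would precede [x], so
       [x] could not have the smaller entry. *)
    rewrite !slotB // ltn_double => lt_xy; rewrite -precedes_total; last first.
      by apply: contraTneq lt_xy => ->; rewrite ltnn.
    apply: contraTN lt_xy => prec_yx; rewrite -leqNgt.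
    rewrite -(eqP (lev_eq x Bx)) -(eqP (lev_eq y By)).
    apply/subset_leq_card/subsetP => z.
    by rewrite !inE => /andP[-> prec_zy]; apply: precedes_trans prec_yx.
split.
  case def_u: u => [//|x0 u']; rewrite -def_u.
  apply/(sortedP x0) => i lt_i.
  have ui1 := mem_nth x0 lt_i; have ui := mem_nth x0 (ltnW lt_i).
  apply: mono; rewrite ?inE -?uA ?ui ?ui1 //.
  by rewrite /slot ui ui1 !index_uniq // ?(ltnW lt_i) // ltnS ltn_double.
apply/forall_inP => b Bb.
have lev_size : lev b <= size u by rewrite size_u lev_le.
(* The symbols of [A] before [b] will be the first [lev b] entries of [u]. *)
have take_size : size (take (lev b) u) = lev b by rewrite size_takel.
rewrite -[X in _ == X]take_size -(card_uniqP (take_uniq _ uniq_u)).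
apply/eqP/eq_card => x; rewrite inE.
case: (boolP (x \in A)) => /= [Ax|nAx]; last first.
  by apply/esym/negbTE; apply: contra nAx => /mem_take; rewrite uA.
rewrite in_take ?uA //.
have [lt_x|le_x] := ltnP (index x u) (lev b).
  by apply: mono; rewrite ?inE ?Ax ?Bb ?orbT // (slotA x) // slotB //; lia.
apply/negbTE; rewrite precedes_total ?neqAB //.
by apply: mono; rewrite ?inE ?Ax ?Bb ?orbT // (slotA x) // slotB //; lia.
Qed.

(** An odd slot holds at most one symbol, so only the even ones contribute. *)
Lemma count_slot_sorted A B u lev :
    perm_eq u (enum A) -> [disjoint A & B] -> {in B, forall b, lev b <= #|A|} ->
  count (sorted (relpre (slot u lev) leq)) (permutations (enum (A :|: B))) =
    \prod_(i < #|A|.+1) #|[set b in B | lev b == i]|`!.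
Proof.
move=> perm_u disjAB lev_le.
have uA x : (x \in u) = (x \in A) by rewrite (perm_mem perm_u) mem_enum.
have uB x : x \in B -> (x \in u) = false.
  by rewrite uA => /(disjointFl disjAB).
have size_u : size u = #|A| by rewrite (perm_size perm_u) -cardE.
rewrite (@count_key_sorted _ _ (#|A|.+1).*2) ?enum_uniq //; last first.
  apply/allP => x; rewrite mem_enum inE /slot uA.
  case: (boolP (x \in A)) => [Ax _|_ /= /lev_le le_x].
    by rewrite doubleS !ltnS leq_double -size_u ltnW // index_mem uA.
  by rewrite ltn_double.
have count_card k : count (fun x => slot u lev x == k) (enum (A :|: B)) =
                    #|[set x in A :|: B | slot u lev x == k]|.
  rewrite -size_filter cardE /enum_mem -filter_predI.
  by congr size; apply: eq_filter => x; rewrite !inE andbC.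
rewrite (prod_even_odd
  (fun k => (count (fun x => slot u lev x == k) (enum (A :|: B)))`!)).
apply: eq_bigr => i _; rewrite !count_card.
have -> : #|[set x in A :|: B | slot u lev x == i.*2.+1]|`! = 1.
  have: #|[set x in A :|: B | slot u lev x == i.*2.+1]| <= 1.
    apply/card_le1_eqP => x y; rewrite !inE /slot => /andP[_ kx] /andP[_ ky].
    move: kx ky; case: ifP => [ux|_] kx; last by lia.
    case: ifP => [uy|_] ky; last by lia.
    apply: (index_inj x uy ux); apply: double_inj; apply: succn_inj.
    by rewrite (eqP kx) (eqP ky).
  by case: #|_| => [|[]].
rewrite muln1; congr (_`!); apply: eq_card => x; rewrite !inE /slot -uA.
case: (boolP (x \in B)) => [/uB-> /=|_]; first by rewrite (inj_eq double_inj).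
by rewrite orbF; case: (x \in u) => //=; lia.
Qed.
End Restriction.

(** Covering rows and [mu T] are both expressed through one predicate on the
    orderings of a set of [t] symbols, so that the two parts of the theorem differ
    only in how the array meets those orderings. *)
Lemma card_covering_rows (v a t : nat) (X : {set 'S_v}) (c : ordered_choice a v)
    (T : {set array_col (calC X c) * 'I_a.+1}) :
  a < t -> is_interaction (t - a) T ->
  exists (S : {set 'I_v}) (P : pred (seq 'I_v)),
  [/\ #|S| = t,
      #|covering_rows T| = #|[set pi in X | P (restriction pi S)]| &
      count P (permutations (enum S)) = mu T].
Proof.
case: c T => [[A u] choiceP] /= T lt_at [cardT injT].
have /andP[/= /eqP cardA perm_u] := choiceP.
pose B := [set val p.1 | p in T].
(* On [B] the sum has a single term, since a column occurs once in [T]. *)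
pose lev x := \sum_(p in T | val p.1 == x) (p.2 : nat).
have levE p : p \in T -> lev (val p.1) = p.2.
  move=> Tp; rewrite /lev (bigD1 p) ?Tp ?eqxx //= big1 ?addn0 // => q.
  case/andP=> /andP[Tq /eqP/val_inj eq_pq] /eqP[]; exact: injT eq_pq.
have cardB : #|B| = t - a.
  by rewrite card_in_imset // => p q Tp Tq /val_inj; apply: injT.
have disjAB : [disjoint A & B].
  rewrite disjoint_sym; apply/pred0P => x /=; apply/negbTE/negP => /andP[].
  by case/imsetP=> p _ ->; rewrite (negPf (valP p.1)).
have lev_le : {in B, forall b, lev b <= #|A|}.
  by move=> _ /imsetP[p Tp ->]; rewrite levE // cardA -ltnS ltn_ord.
exists (A :|: B), (sorted (relpre (slot u lev) leq)); split.
- move: (disjAB); rewrite -leq_card_setU => /eqP->; rewrite cardA cardB; lia.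
- rewrite -(card_imset _ val_inj); apply: eq_card => pi.
  rewrite inE -row_coversE //.
  apply/imsetP/and3P => [[rho rhoT ->]|[Xpi cov lv]].
    have := valP rho; rewrite inE => /andP[-> ->]; split=> //.
    apply/forall_inP => _ /imsetP[p Tp ->]; rewrite levE //.
    by move: rhoT; rewrite inE => /forall_inP/(_ p Tp).
  have rhoP : pi \in [set pi in X | covers pi u] by rewrite inE Xpi.
  exists (exist _ pi rhoP) => //; rewrite inE; apply/forall_inP => p Tp /=.
  by rewrite -levE //; apply: (forall_inP lv); apply: imset_f.
- rewrite count_slot_sorted // cardA; apply: eq_bigr => i _; congr (_`!).
  rewrite -(card_imset _ val_inj); apply: eq_card => x.
  rewrite inE; apply/andP/imsetP => [[/imsetP[p Tp ->]]|[nu]].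
    rewrite levE // => /eqP/val_inj eq_i; exists p.1 => //.
    by rewrite inE -eq_i -surjective_pairing.
  rewrite inE => Tnu ->; split; first by apply/imsetP; exists (nu, i).
  by rewrite (levE (nu, i)).
Qed.

Theorem lemma4 (v t N a : nat) (X : {set 'S_v}) :
  0 < t -> 0 < v -> t <= v -> is_SCA N t X -> 0 < a < t ->
  (forall c : ordered_choice a v,
     is_CAX #|array_row (calC X c)| (t - a) (v - a) a.+1 (calC X c)) /\
  (is_SCA t`! t X ->
   forall (c : ordered_choice a v)
          (T : {set array_col (calC X c) * 'I_a.+1}),
     is_interaction (t - a) T -> #|covering_rows T| = mu T).
Proof.
move=> _ _ _ scaX /andP[_ lt_at]; split=> [c | scaX' c T intT]; last first.
  have [S [P [cardS -> <-]]] := card_covering_rows lt_at intT.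
  exact: SCA_count_eq scaX' cardS.
have cardA : #|(val c).1| = a by case/andP: (valP c) => /eqP.
split=> // [|rho nu|T intT].
- rewrite card_sig; have := cardC (mem (val c).1).
  by rewrite card_ord cardA => /(canRL (addKn a)) <-; apply: eq_card.
- rewrite ltnS -[X in _ <= X]cardA; apply/subset_leq_card/subsetP => x.
  by rewrite inE => /andP[].
have [S [P [cardS -> <-]]] := card_covering_rows lt_at intT.
exact: SCA_count_ge scaX cardS.
Qed.
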